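(* For every integer $d\geq 2$ and every $d$-partite graph $F$, there exist $a_{F,d}\in\mathbb{Z}_{\geq 0}$ and $C_{F,d}\in\mathbb{Z}$ such that $$\mathrm{rk}\text{-}\mathrm{sat}(K^{(2)}_{n,d},F)=a_{F,d}\,n+C_{F,d}$$ for all sufficiently large $n$.
   Context: $K^{(2)}_{n,d}$ is the complete $d$-partite graph with $d$ parts each of size $n$. A matroid $M$ on $E(G)$ is weakly $F$-saturated if every copy $\tilde F$ of $F$ in $G$ is a cycle of $M$, i.e. $\mathrm{rk}_M(E(\tilde F)\setminus\{e\})=\mathrm{rk}_M(E(\tilde F))$ for all $e\in E(\tilde F)$; $\mathrm{rk}\text{-}\mathrm{sat}(G,F)$ is the maximum rank of a weakly $F$-saturated matroid on $E(G)$.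
   Formalization: The graph F is assumed to have at least one edge; for edgeless F every matroid is weakly F-saturated, so rk-sat equals the number of edges of the host graph, binom(d,2) n^2, which is not linear in n. *)

(* Defs.v *)
From HB Require Import structures.
From mathcomp Require Import all_boot all_order all_algebra.
Set Implicit Arguments. Unset Strict Implicit. Unset Printing Implicit Defensive.

(* A simple graph is a symmetric irreflexive relation [adj] on a finite vertex type. *)

Definition is_edge (V : finType) (adj : rel V) (e : {set V}) : bool :=
  [exists u, exists v, adj u v && (e == [set u; v])].

Definition Edge (V : finType) (adj : rel V) := {e : {set V} | is_edge adj e}.

Definition matroid_rank (E : finType) (rk : {set E} -> nat) : Prop :=
  [/\ (forall A : {set E}, rk A <= #|A|),
      (forall A B : {set E}, A \subset B -> rk A <= rk B) &
      (forall A B : {set E}, rk (A :|: B) + rk (A :&: B) <= rk A + rk B)].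

Definition copy_edges (T V : finType) (adjF : rel T) (adj : rel V)
  (phi : T -> V) : {set Edge adj} :=
  [set e : Edge adj | [exists x, exists y, adjF x y && (val e == [set phi x; phi y])]].

Definition is_copy (T V : finType) (adjF : rel T) (adj : rel V) (phi : T -> V) : Prop :=
  injective phi /\ (forall x y, adjF x y -> adj (phi x) (phi y)).

(* Matroid on E(G) is weakly F-saturated: every copy of F is a cycle. *)
Definition weakly_sat (T V : finType) (adjF : rel T) (adj : rel V)
  (rk : {set Edge adj} -> nat) : Prop :=
  forall phi : T -> V, is_copy adjF adj phi ->
    forall e, e \in copy_edges adjF adj phi ->
      rk (copy_edges adjF adj phi :\ e) = rk (copy_edges adjF adj phi).

Definition is_rk_sat (T V : finType) (adjF : rel T) (adj : rel V) (r : nat) : Prop :=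
  (exists rk : {set Edge adj} -> nat, [/\ matroid_rank rk, weakly_sat adjF rk & rk setT = r]) /\
  (forall rk : {set Edge adj} -> nat, matroid_rank rk -> weakly_sat adjF rk -> rk setT <= r).

Definition Kpart (n d : nat) : rel ('I_d * 'I_n)%type := fun u v => u.1 != v.1.

Definition d_partite (T : finType) (adjF : rel T) (d : nat) : Prop :=
  exists c : T -> 'I_d, forall x y, adjF x y -> c x != c y.
Arguments Kpart : clear implicits.

(* Main.v *)
Require Import Defs.
From HB Require Import structures.
From mathcomp Require Import all_boot all_order all_algebra all_fingroup.
From mathcomp Require Import zify.
From Stdlib Require Import Classical.

(** Fix a weakly [F]-saturated matroid on [K_{n,d}].  If two vertex sets [A]
    and [B] share [#|F|] vertices of each part, every edge between them lies in
    a copy of [F] whose other edges are inside [A] or inside [B].  Hence the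
    induced edge sets of [A] and [B] span that of [A :|: B], and the rank is
    submodular as a function of vertex sets above a fixed core.

    Call a layer the [d] vertices with a given second coordinate.  Let [a] be
    the largest integer such that, for arbitrarily large [n], some weakly
    saturated matroid on [K_{n,d}] drops rank by at least [a] whenever a layer
    is deleted.  By maximality [rk-sat(n+1) <= rk-sat(n) + a] for large [n].  By
    submodularity layer deletion costs at least [a] also after restriction to
    fewer layers, so [rk-sat(n) >= a (n - #|F|)] for all [n].  Thus
    [rk-sat(n) - a n] is eventually nonincreasing and bounded below. *)

Set Implicit Arguments.
Unset Strict Implicit.
Unset Printing Implicit Defensive.

(** * Extremal elements of sets of natural numbers *)

Lemma exists_least (P : nat -> Prop) :
  (exists n, P n) -> exists n, P n /\ forall m, P m -> n <= m.
Proof.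
case=> n; elim/ltn_ind: n => n IHn Pn.
case: (classic (exists2 m, m < n & P m)) => [[m ltmn Pm]|noP]; first exact: IHn Pm.
by exists n; split=> // m Pm; rewrite leqNgt; apply/negP => ltmn; case: noP; exists m.
Qed.

Lemma exists_greatest (P : nat -> Prop) D :
  (exists n, P n) -> (forall n, P n -> n <= D) ->
  exists n, P n /\ forall m, P m -> m <= n.
Proof.
move=> [n0 Pn0] leD.
(* The reflection [n -> D - n] turns a greatest element into a least one. *)
have [|b [[n Pn defb] minb]] := @exists_least (fun b => exists2 n, P n & b = D - n).
  by exists (D - n0), n0.
exists n; split=> // m Pm.
have := minb (D - m) (ex_intro2 _ _ m Pm erefl).
by move: (leD _ Pm) (leD _ Pn); lia.
Qed.

(** * Spanning in terms of the rank function *)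

Section MatroidRank.
Variables (E : finType) (rk : {set E} -> nat).
Hypothesis rkM : matroid_rank rk.

(** [X :&: C] contains [C :\ e], so it has the full rank of [C]; submodularity for [X] and [C] then
    leaves [e] nothing to add to [X]. *)
Lemma rank_span_element (X C : {set E}) (e : E) :
  e \in C -> C :\ e \subset X -> rk (C :\ e) = rk C -> rk (e |: X) = rk X.
Proof.
have [_ mono submod] := rkM => eC sCX rkC.
apply/eqP; rewrite eqn_leq (mono X) ?subsetUr // andbT.
have sXC : e |: X \subset X :|: C by rewrite subUset sub1set inE eC orbT subsetUl.
have : rk C <= rk (X :&: C) by rewrite -rkC mono // subsetI sCX subsetDl.
by have := submod X C; have := mono _ _ sXC; lia.
Qed.

Lemma rank_span (X Y : {set E}) :
  (forall e, e \in Y -> rk (e |: X) = rk X) -> rk (X :|: Y) = rk X.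
Proof.
have [_ mono submod] := rkM.
have [n leYn] := ubnP #|Y|; elim: n Y leYn => // n IHn Y leYn spanY.
have [->|[e eY]] := set_0Vmem Y; first by rewrite setU0.
have rkY : rk (X :|: Y :\ e) = rk X.
  apply: IHn => [|f]; first by move: leYn; rewrite (cardsD1 e) eY; lia.
  by rewrite in_setD1 => /andP[_]; apply: spanY.
apply/eqP; rewrite eqn_leq [X in _ && X]mono ?subsetUl // andbT.
(* Both sets on the right have the rank of [X] and their intersection contains [X], so submodularity
   bounds their union. *)
have -> : X :|: Y = (X :|: Y :\ e) :|: (e |: X).
  apply/setP=> f; rewrite !inE; case: eqVneq => [->|_]; first by rewrite eY !orbT.
  by case: (f \in X); rewrite ?orbF.
have := submod (X :|: Y :\ e) (e |: X); rewrite rkY spanY //.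
suff : rk X <= rk ((X :|: Y :\ e) :&: (e |: X)) by lia.
by rewrite mono // subsetI subsetUl subsetUr.
Qed.

End MatroidRank.

(** * Edges induced by a vertex set *)

Section InducedEdges.
Variables (V : finType) (adj : rel V).

Definition induced_edges (A : {set V}) : {set Edge adj} :=
  [set e : Edge adj | val e \subset A].

Lemma edgeP (e : Edge adj) : exists u v, adj u v /\ val e = [set u; v].
Proof.
by have /existsP[u /existsP[v /andP[uv /eqP ->]]] := valP e; exists u, v.
Qed.

Lemma induced_edgesI (A B : {set V}) :
  induced_edges A :&: induced_edges B = induced_edges (A :&: B).
Proof. by apply/setP=> e; rewrite !inE subsetI. Qed.

Lemma induced_edgesT : induced_edges setT = setT.
Proof. by apply/setP=> e; rewrite !inE subsetT. Qed.

End InducedEdges.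

(** * Restriction of matroids along induced embeddings of graphs *)

Section Pullback.
Variables (V W : finType) (adjV : rel V) (adjW : rel W) (j : V -> W).
Hypothesis j_inj : injective j.
Hypothesis adj_j : forall u v, adjW (j u) (j v) = adjV u v.

Lemma edge_image_subproof (e : Edge adjV) : is_edge adjW (j @: val e).
Proof.
have [u [v [uv ->]]] := edgeP e.
by apply/existsP; exists (j u); apply/existsP; exists (j v);
  rewrite adj_j uv imsetU !imset_set1 eqxx.
Qed.

Definition edge_image (e : Edge adjV) : Edge adjW :=
  exist (is_edge adjW) _ (edge_image_subproof e).

Lemma edge_image_inj : injective edge_image.
Proof.
by move=> e f /(congr1 val) /= /(imset_inj j_inj) /val_inj.
Qed.

Lemma edge_image_setT :
  edge_image @: setT = induced_edges adjW (j @: [set: V]).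
Proof.
apply/setP=> e; rewrite inE; apply/imsetP/idP => [[f _ ->]|sub_e].
  by rewrite /= imsetS ?subsetT.
have [u [v [uv def_e]]] := edgeP e.
move: sub_e; rewrite def_e subUset !sub1set.
case/andP => /imsetP[u' _ def_u] /imsetP[v' _ def_v].
have uv' : is_edge adjV [set u'; v'].
  apply/existsP; exists u'; apply/existsP; exists v'.
  by rewrite -adj_j -def_u -def_v uv eqxx.
exists (exist (is_edge adjV) _ uv') => //; apply: val_inj.
by rewrite /= def_e imsetU !imset_set1 def_u def_v.
Qed.

Lemma edge_image_copy (T : finType) (adjF : rel T) (phi : T -> V) :
  is_copy adjF adjV phi ->
  edge_image @: copy_edges adjF adjV phi = copy_edges adjF adjW (j \o phi).
Proof.
move=> [_ phi_adj]; apply/setP=> e; rewrite inE; apply/imsetP/idP.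
  case=> f; rewrite inE => /existsP[x /existsP[y /andP[xy /eqP def_f]]] ->.
  apply/existsP; exists x; apply/existsP; exists y.
  by rewrite xy /= def_f imsetU !imset_set1 eqxx.
case/existsP=> x /existsP[y /andP[xy /eqP def_e]].
have xyV : is_edge adjV [set phi x; phi y].
  by apply/existsP; exists (phi x); apply/existsP; exists (phi y);
    rewrite phi_adj ?eqxx.
exists (exist (is_edge adjV) _ xyV).
  by rewrite inE; apply/existsP; exists x; apply/existsP; exists y; rewrite xy /=.
by apply: val_inj; rewrite /= def_e imsetU !imset_set1.
Qed.

Definition pullback_rank (rk : {set Edge adjW} -> nat) (X : {set Edge adjV}) :=
  rk (edge_image @: X).

Lemma pullback_matroid rk : matroid_rank rk -> matroid_rank (pullback_rank rk).
Proof.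
move=> [rk_card mono submod]; split=> [A|A B sAB|A B]; rewrite /pullback_rank.
- exact: leq_trans (rk_card _) (leq_imset_card _ _).
- exact/mono/imsetS.
- by rewrite imsetU imsetI ?submod // => e f _ _; apply: edge_image_inj.
Qed.

(** Composing with [j] turns copies of [F] into copies of [F], and [edge_image] matches their edge
    sets. *)
Lemma pullback_weakly_sat (T : finType) (adjF : rel T) rk :
  weakly_sat adjF rk -> weakly_sat adjF (pullback_rank rk).
Proof.
move=> rk_sat phi phi_copy e e_phi; rewrite /pullback_rank.
have [phi_inj phi_adj] := phi_copy.
have -> : edge_image @: (copy_edges adjF adjV phi :\ e)
        = (edge_image @: copy_edges adjF adjV phi) :\ edge_image e.
  apply/setP=> f; rewrite in_setD1; apply/imsetP/andP => [[g]|[ne /imsetP[g g_phi eq_f]]].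
    rewrite in_setD1 => /andP[ne g_phi] ->.
    by rewrite (inj_eq edge_image_inj) ne imset_f.
  by exists g; rewrite // in_setD1 g_phi andbT; apply: contraNneq ne => <-; apply/eqP.
have : edge_image e \in edge_image @: copy_edges adjF adjV phi by apply: imset_f.
rewrite edge_image_copy //; apply: rk_sat; split; first exact: inj_comp.
by move=> x y xy; rewrite /= adj_j phi_adj.
Qed.

End Pullback.

(** * Weakly saturated matroids on complete multipartite graphs *)

Lemma exists_perm2 (I : finType) (a b i j : I) :
  a != b -> i != j -> exists s : {perm I}, s a = i /\ s b = j.
Proof.
move=> neq_ab neq_ij; exists (tperm a i * tperm (tperm a i b) j)%g.
split; rewrite permM tpermL // tpermD // 1?eq_sym //.
by rewrite -{1}(tpermL a i) (inj_eq perm_inj).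
Qed.

Section WeakSaturation.
Variables (d : nat) (T : finType) (adjF : rel T).
Hypothesis F_partite : d_partite adjF d.
Hypothesis F_edge : exists x y, adjF x y.

Notation K n := (Kpart n d).

Definition below (n i : nat) : {set 'I_d * 'I_n} := [set v : 'I_d * 'I_n | v.2 < i].

Definition avoid_layer n (s : 'I_n) : {set 'I_d * 'I_n} := [set v : 'I_d * 'I_n | v.2 != s].

(** Permuting the colours of [F] puts the ends of one edge [x y] into the parts of [u] and [v].
    Every other vertex goes to the layer given by its rank in [T]; these layers are distinct, whence
    injectivity. *)
Lemma copy_through_edge n (u v : 'I_d * 'I_n) :
  #|T| <= n -> u.1 != v.1 -> u \notin below n #|T| -> v \notin below n #|T| ->
  exists x y phi, [/\ adjF x y, is_copy adjF (K n) phi, phi x = u, phi y = v &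
    forall z, z != x -> z != y -> phi z \in below n #|T|].
Proof.
move=> leTn uv uN vN; have [c c_proper] := F_partite; have [x [y xy]] := F_edge.
have [s [sx sy]] := exists_perm2 (c_proper _ _ xy) uv.
pose core z : 'I_d * 'I_n := (s (c z), widen_ord leTn (enum_rank z)).
pose phi z := if z == x then u else if z == y then v else core z.
have coreP z : core z \in below n #|T| by rewrite inE /= ltn_ord.
have phi_part z : (phi z).1 = s (c z).
  by rewrite /phi; case: eqP => [->|_] //; case: eqP => [->|_].
have neq_yx : y != x by apply/eqP=> eq_yx; move: uv; rewrite -sx -sy eq_yx eqxx.
have neq_uv : u != v by apply: contraNneq uv => ->.
have core_u z : core z != u by apply: contraNneq uN => <-.
have core_v z : core z != v by apply: contraNneq vN => <-.
exists x, y, phi; split=> //.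
- split=> [z w|z w zw].
    rewrite /phi; case: (eqVneq z x) => [->|_]; case: (eqVneq w x) => [->|_] //.
    + case: (eqVneq w y) => [_ /eqP|_ /esym/eqP]; first by rewrite (negPf neq_uv).
      by rewrite (negPf (core_u _)).
    + case: (eqVneq z y) => [_ /esym/eqP|_ /eqP]; first by rewrite (negPf neq_uv).
      by rewrite (negPf (core_u _)).
    case: (eqVneq z y) => [->|_]; case: (eqVneq w y) => [->|_] //.
    + by move/esym/eqP; rewrite (negPf (core_v _)).
    + by move/eqP; rewrite (negPf (core_v _)).
    by case=> _ /val_inj/enum_rank_inj.
  by rewrite /Kpart !phi_part (inj_eq perm_inj) c_proper.
- by rewrite /phi eqxx.
- by rewrite /phi (negPf neq_yx) eqxx.
- by move=> z zx zy; rewrite /phi (negPf zx) (negPf zy).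
Qed.

(** * Submodularity of the rank over vertex sets *)

Section FixedMatroid.
Variables (n : nat) (rk : {set Edge (K n)} -> nat).
Hypotheses (rkM : matroid_rank rk) (rk_sat : weakly_sat adjF rk).
Hypothesis leTn : #|T| <= n.

(** In the copy through [e], only [v] lies outside [A] and only [u] outside [B]. Every other edge
    misses [u] or [v], hence is induced by [B] or by [A]. *)
Lemma rank_span_crossing_edge (A B : {set 'I_d * 'I_n}) (e : Edge (K n)) u v :
  below n #|T| \subset A -> below n #|T| \subset B -> u.1 != v.1 ->
  u \in A -> u \notin B -> v \in B -> v \notin A -> val e = [set u; v] ->
  rk (e |: (induced_edges (K n) A :|: induced_edges (K n) B))
  = rk (induced_edges (K n) A :|: induced_edges (K n) B).
Proof.
move=> sTA sTB uv uA uB vB vA def_e.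
have [] := copy_through_edge leTn uv (contra (subsetP sTB u) uB) (contra (subsetP sTA v) vA).
move=> x [y [phi [xy phi_copy phi_x phi_y phi_core]]].
have e_phi : e \in copy_edges adjF (K n) phi.
  rewrite inE; apply/existsP; exists x; apply/existsP; exists y.
  by rewrite xy def_e phi_x phi_y /=.
apply: (rank_span_element rkM e_phi); last exact: rk_sat.
have phiA z : z != y -> phi z \in A.
  have [->|zx zy] := eqVneq z x; first by rewrite phi_x.
  exact/(subsetP sTA)/phi_core.
have phiB z : z != x -> phi z \in B.
  have [->|zy zx] := eqVneq z y; first by rewrite phi_y.
  exact/(subsetP sTB)/phi_core.
apply/subsetP=> f; rewrite !inE => /andP[neq_fe].
case/existsP=> z /existsP[w /andP[zw /eqP def_f]].
have [_ phi_adj] := phi_copy.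
have neq_zw : z != w by apply/eqP=> eq_zw; have := phi_adj _ _ zw; rewrite eq_zw /Kpart eqxx.
rewrite def_f !subUset !sub1set.
have neq_f a b : a = x -> b = y -> val f = [set phi a; phi b] -> False.
  move=> -> -> eq_f; move: neq_fe; rewrite -val_eqE /= eq_f def_e phi_x phi_y.
  by rewrite eqxx.
have [zx|zx] := eqVneq z x; have [wx|wx] := eqVneq w x.
- by rewrite zx wx eqxx in neq_zw.
- have wy : w != y by apply/eqP=> wy; apply: neq_f zx wy def_f.
  by rewrite !phiA // zx; apply: contraNneq uv => eq_xy; rewrite -phi_x -phi_y eq_xy.
- have zy : z != y by apply/eqP=> zy; apply: neq_f wx zy _; rewrite def_f setUC.
  by rewrite !phiA // wx; apply: contraNneq uv => eq_xy; rewrite -phi_x -phi_y eq_xy.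
- by rewrite !phiB // orbT.
Qed.

(** The only edges missing from [X] join [A :\: B] to [B :\: A], and these are spanned by [X]. *)
Lemma rank_induced_edgesU (A B : {set 'I_d * 'I_n}) :
  below n #|T| \subset A -> below n #|T| \subset B ->
  rk (induced_edges (K n) (A :|: B))
  <= rk (induced_edges (K n) A :|: induced_edges (K n) B).
Proof.
move=> sTA sTB.
set X := induced_edges (K n) A :|: induced_edges (K n) B.
have [_ mono _] := rkM.
apply: leq_trans (mono _ _ (subsetUr X (induced_edges (K n) (A :|: B)))) _.
rewrite rank_span // => e.
have inX : e \in X -> rk (e |: X) = rk X by move=> eX; congr rk; apply/setUidPr; rewrite sub1set.
have [u [v [uv def_e]]] := edgeP e.
rewrite inE def_e subUset !sub1set !inE.
case: (boolP (u \in A)) => uA; case: (boolP (v \in A)) => vA.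
- by move=> _; apply: inX; rewrite !inE def_e !subUset !sub1set uA vA.
- case: (boolP (u \in B)) => uB /= vB.
    by apply: inX; rewrite !inE def_e !subUset !sub1set uB vB orbT.
  exact: rank_span_crossing_edge uA uB vB vA def_e.
- case: (boolP (v \in B)) => vB; rewrite ?andbT => /= uB.
    by apply: inX; rewrite !inE def_e !subUset !sub1set uB vB orbT.
  by apply: (@rank_span_crossing_edge A B e v u) => //; rewrite 1?eq_sym // def_e setUC.
- by move=> uvB; apply: inX; rewrite !inE def_e !subUset !sub1set uvB orbT.
Qed.

(** [below n s.+1] and [avoid_layer s] cover all vertices and meet in [below n s]; [#|T| <= s] keeps
    the core inside both. *)
Lemma rank_below_add_layer a (s : 'I_n) : #|T| <= s ->
  rk (induced_edges (K n) (avoid_layer s)) + a <= rk setT ->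
  rk (induced_edges (K n) (below n s)) + a
  <= rk (induced_edges (K n) (below n s.+1)).
Proof.
move=> leTs drop; have [_ mono submod] := rkM.
have := submod (induced_edges (K n) (below n s.+1)) (induced_edges (K n) (avoid_layer s)).
have := @rank_induced_edgesU (below n s.+1) (avoid_layer s).
have -> : below n s.+1 :|: avoid_layer s = setT.
  by apply/setP=> v; rewrite !inE -val_eqE /=; lia.
rewrite induced_edgesI.
have -> : below n s.+1 :&: avoid_layer s = below n s.
  by apply/setP=> v; rewrite !inE -val_eqE /=; lia.
rewrite induced_edgesT => le_rkU.
suff : rk setT <= rk (induced_edges (K n) (below n s.+1)
                      :|: induced_edges (K n) (avoid_layer s)) by move: drop; lia.
apply: le_rkU; apply/subsetP=> v; rewrite !inE.
  by move=> lt_vT; lia.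
by move=> lt_vT; apply/eqP=> eq_vs; move: lt_vT; rewrite eq_vs; lia.
Qed.

Lemma rank_below_linear a :
  (forall s : 'I_n, rk (induced_edges (K n) (avoid_layer s)) + a <= rk setT) ->
  forall i, i <= n -> a * (i - #|T|) <= rk (induced_edges (K n) (below n i)).
Proof.
move=> drop; elim=> [|i IHi] lt_in; first by rewrite sub0n muln0.
(* Within the core the truncated subtraction makes the bound zero. *)
have [leiT|leTi] := leqP i.+1 #|T|; first by rewrite (eqP leiT) muln0.
have := @rank_below_add_layer a (Ordinal lt_in) leTi (drop _).
have := IHi (ltnW lt_in); rewrite subSn //= mulnS; lia.
Qed.

End FixedMatroid.

(** * Cost of deleting a layer and growth of the rank *)

Definition weak_rank n r :=
  exists rk : {set Edge (K n)} -> nat,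
    [/\ matroid_rank rk, weakly_sat adjF rk & rk setT = r].

(** One matroid must lose [a] at every layer, so if this fails, each weakly saturated matroid has a
    layer that is cheap to delete. *)
Definition layer_drop a n :=
  exists rk : {set Edge (K n)} -> nat, [/\ matroid_rank rk, weakly_sat adjF rk &
    forall s : 'I_n, rk (induced_edges (K n) (avoid_layer s)) + a <= rk setT].

(** Any [m] layers induce a copy of [K m], along which the matroid is pulled back. *)
Lemma weak_rank_layers m n (f : 'I_m -> 'I_n) (rk : {set Edge (K n)} -> nat) :
  injective f -> matroid_rank rk -> weakly_sat adjF rk ->
  weak_rank m (rk (induced_edges (K n) [set v : 'I_d * 'I_n | v.2 \in codom f])).
Proof.
move=> f_inj rkM rk_sat; pose j (v : 'I_d * 'I_m) := (v.1, f v.2).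
have j_inj : injective j by move=> [i x] [i' x'] [-> /f_inj ->].
have adj_j u v : K n (j u) (j v) = K m u v by [].
exists (pullback_rank adj_j rk); split.
- exact: pullback_matroid.
- exact: pullback_weakly_sat.
rewrite /pullback_rank edge_image_setT //; congr (rk (induced_edges _ _)).
apply/setP=> [[i y]]; rewrite inE; apply/imsetP/codomP => [[v _ [_ ->]]|[x /= ->]].
  by exists v.2.
by exists (i, x).
Qed.

Lemma weak_rank_le n r : weak_rank n r -> r <= #|{: Edge (K n)}|.
Proof. by case=> rk [[rk_card _ _] _ <-]; rewrite -cardsT. Qed.

Lemma weak_rank0 n : weak_rank n 0.
Proof. by exists (fun=> 0); split. Qed.

Lemma is_rk_sat_exists n : exists r, is_rk_sat adjF (K n) r.
Proof.
have [|r [wr max_r]] := exists_greatest _ (@weak_rank_le n).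
  by exists 0; apply: weak_rank0.
by exists r; split=> // rk rkM rk_sat; apply: max_r; exists rk.
Qed.

Lemma layer_drop_weak_rank a :
  (forall N, exists2 n, N <= n & layer_drop a n) ->
  forall m, exists2 r, weak_rank m r & a * (m - #|T|) <= r.
Proof.
(* The choice [m + #|T|] makes room both for [m] layers and for the core. *)
move=> drop m; have [n leNn [rk [rkM rk_sat rk_drop]]] := drop (m + #|T|).
have le_mn : m <= n by lia.
exists (rk (induced_edges (K n) [set v : 'I_d * 'I_n | v.2 \in codom (widen_ord le_mn)])).
  by apply: weak_rank_layers => // x y /(congr1 val) /= /val_inj.
rewrite (_ : finset _ = below n m); first by apply: rank_below_linear => //; lia.
apply/setP=> v; rewrite !inE; apply/codomP/idP => [[x ->]|lt_vm]; first exact: (ltn_ord x).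
by exists (Ordinal lt_vm); apply: val_inj.
Qed.

Lemma exists_max_layer_drop : exists a,
  (forall N, exists2 n, N <= n & layer_drop a n) /\
  exists N, forall n, N <= n -> ~ layer_drop a.+1 n.
Proof.
pose P a := forall N, exists2 n, N <= n & layer_drop a n.
(* With exactly one layer beyond the core the lower bound on the rank is [a] itself, so the number
   of edges there bounds [a]. *)
have [||a [Pa max_a]] := @exists_greatest P #|{: Edge (K #|T|.+1)}|.
- exists 0 => N; exists N => //; exists (fun=> 0); split=> //.
- move=> a /layer_drop_weak_rank/(_ #|T|.+1)[r /weak_rank_le le_r].
  by rewrite subSnn muln1 => /leq_trans; apply.
exists a; split=> //.
have : ~ P a.+1 by move/max_a; rewrite ltnn.
move=> /not_all_ex_not[N noN]; exists N => n leNn drop.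
by apply: noN; exists n.
Qed.

(** An optimal matroid on [n.+1] layers has a layer [s] whose deletion costs at most [a]; the other
    layers form a copy of [K n] through [lift s]. *)
Lemma is_rk_sat_step a n r r' : ~ layer_drop a.+1 n.+1 ->
  is_rk_sat adjF (K n) r -> is_rk_sat adjF (K n.+1) r' -> r' <= r + a.
Proof.
move=> no_drop [_ max_r] [[rk [rkM rk_sat <-]] _].
have [s drop_s] : exists s, rk setT < rk (induced_edges (K n.+1) (avoid_layer s)) + a.+1.
  apply: NNPP => no_s; apply: no_drop; exists rk; split=> // s.
  by rewrite leqNgt; apply/negP => drop_s; apply: no_s; exists s.
have [rk' [rkM' rk_sat' def_rk']] := weak_rank_layers (@lift_inj _ s) rkM rk_sat.
have := max_r _ rkM' rk_sat'; rewrite def_rk'.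
suff -> : [set v : 'I_d * 'I_n.+1 | v.2 \in codom (lift s)] = avoid_layer s.
  by move: drop_s; lia.
apply/setP=> v; rewrite !inE eq_sym; apply/codomP/idP => [[x ->]|]; first exact: neq_lift.
by case/unlift_some=> x -> _; exists x.
Qed.

Lemma is_rk_sat_eventually_linear :
  exists (a : nat) (C : int) (N : nat), forall n : nat, N <= n ->
    exists r : nat, is_rk_sat adjF (K n) r /\ (r%:Z = (a * n)%:Z + C)%R.
Proof.
have [a [drop [N no_drop]]] := exists_max_layer_drop.
have rk_ge n r : is_rk_sat adjF (K n) r -> a * n <= r + a * #|T|.
  case=> _ max_r; have [r' [rk [rkM rk_sat def_r']] le_r'] := layer_drop_weak_rank drop n.
  by have := max_r _ rkM rk_sat; move: le_r'; rewrite def_r' mulnBr; lia.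
(* [b] is the excess of the rank over [a * n], shifted by [a * #|T|] to be a natural number; its
   least value beyond [N] determines [C]. *)
pose Q b := exists n r, [/\ N <= n, is_rk_sat adjF (K n) r & r + a * #|T| = a * n + b].
have [|b [[n0 [r0 [leNn0 sat0 def_b]]] min_b]] := @exists_least Q.
  have [r sat_r] := is_rk_sat_exists N; have := rk_ge _ _ sat_r => le_r.
  by exists (r + a * #|T| - a * N), N, r; split=> //; lia.
exists a, (b%:Z - (a * #|T|)%:Z)%R, n0 => n le_n.
have [r sat_r] := is_rk_sat_exists n; exists r; split=> //.
(* From [n0] on each new layer adds at most [a], so the excess never rises above [b]. *)
have le_b : r + a * #|T| <= a * n + b.
  rewrite -(subnKC le_n) in sat_r *.
  elim: (n - n0) r sat_r => [|m IHm] r; rewrite ?addn0 ?addnS => sat_r.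
    case: sat_r => [[rk [rkM rk_sat <-]] _].
    by have := proj2 sat0 rk rkM rk_sat; lia.
  have [r' sat_r'] := is_rk_sat_exists (n0 + m).
  have no_drop' : ~ layer_drop a.+1 (n0 + m).+1 by apply: no_drop; lia.
  have := is_rk_sat_step no_drop' sat_r' sat_r; have := IHm _ sat_r'.
  by rewrite mulnS; lia.
(* Minimality of [b] gives the reverse bound; [rk_ge] shows that the subtraction is not
   truncated. *)
have : b <= r + a * #|T| - a * n.
  by apply: min_b; exists n, r; split=> //; have := rk_ge _ _ sat_r; lia.
by have := rk_ge _ _ sat_r; lia.
Qed.

End WeakSaturation.

Theorem theorem6 (d : nat) (T : finType) (adjF : rel T) :
  2 <= d -> symmetric adjF -> irreflexive adjF -> d_partite adjF d ->
  (exists x y, adjF x y) ->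
  exists (a : nat) (C : int) (N : nat), forall n : nat, N <= n ->
    exists r : nat, is_rk_sat adjF (Kpart n d) r /\
      (r%:Z = (a * n)%:Z + C)%R.
Proof.
by move=> _ _ _; apply: is_rk_sat_eventually_linear.
Qed.
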